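(* Let $G\le S_n$ be a Frobenius group with Frobenius complement $H$ and Frobenius kernel $N$. The normalized volume of $P(G)$ in the (affine) sublattice of $\mathbb{Z}^{n\times n}$ spanned by its vertices is \[ \frac{1}{(|H||N|-|H|)!} \sum_{\ell = 0}^{\lfloor \frac{|H|(|N|-1)-1}{|N|} \rfloor} \binom{(|H|-\ell)|N|}{(|H|-\ell)|N| - |H|+1} \binom{|H|-1}{\ell} {(-1)}^{\ell}.\]
   Context: Each $g\in S_n$ is identified with the $n\times n$ permutation matrix whose $(i,j)$-entry is $1$ if $g(i)=j$ and $0$ otherwise; for $G\le S_n$, $P(G)=\mathrm{conv}\{g:g\in G\}\subset\mathbb{R}^{n\times n}$. A group $G\le S_n$ is Frobenius if it has a proper subgroup $H$ (the Frobenius complement) such that $H\cap xHx^{-1}=\{e\}$ for all $x\in G\setminus H$. The Frobenius kernel $N$ consists of the identity together with all elements of $G$ having no fixed points; it is a subgroup (of size $n$ in the paper's setting), $N\cap H=\{e\}$ and $G=NH$. The normalized volume of a $d$-dimensional polytope in an affine lattice $L$ is the $d$-dimensional volume normalized so that a $d$-simplex with vertices in $L$ whose edge vectors from one vertex form a basis of $L$ has volume $\frac{1}{d!}$. *)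

(* Defs.v *)
From HB Require Import structures.
From mathcomp Require Import all_boot all_order all_algebra all_fingroup.
From mathcomp Require Import all_classical all_reals all_analysis.
Set Implicit Arguments. Unset Strict Implicit. Unset Printing Implicit Defensive.
Import Order.TTheory GRing.Theory Num.Theory.
Local Open Scope classical_set_scope.
Local Open Scope ring_scope.

Definition pmat (R : realType) (n : nat) (g : {perm 'I_n}) : 'M[R]_n :=
  \matrix_(i < n, j < n) ((g i == j)%:R).

Definition perm_polytope (R : realType) (n : nat) (G : {set {perm 'I_n}})
  : set 'M[R]_n :=
  [set M | exists lam : {perm 'I_n} -> R,
      (forall g, 0 <= lam g) /\ \sum_(g in G) lam g = 1 /\
      M = \sum_(g in G) lam g *: pmat R g].

Definition vertex_lattice (R : realType) (n : nat) (G : {set {perm 'I_n}})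
  : set 'M[R]_n :=
  [set M | exists c : {perm 'I_n} -> int,
      \sum_(g in G) c g = 1 /\ M = \sum_(g in G) (c g)%:~R *: pmat R g].

Definition aff_comb (R : realType) (n d : nat) (p : 'M[R]_n)
  (b : 'I_d -> 'M[R]_n) (t : 'I_d -> R) : 'M[R]_n :=
  p + \sum_(i < d) t i *: b i.

Definition affine_lattice_basis (R : realType) (n d : nat) (L : set 'M[R]_n)
  (p : 'M[R]_n) (b : 'I_d -> 'M[R]_n) : Prop :=
  (forall M, L M <-> exists z : 'I_d -> int, M = aff_comb p b (fun i => (z i)%:~R))
  /\ (forall z : 'I_d -> int,
        \sum_(i < d) (z i)%:~R *: b i = 0 -> forall i, z i = 0).

Definition grid_count (R : realType) (d : nat) (S : set ('I_d -> R)) (k : nat)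
  : \bar R :=
  (\esum_(z in [set z : {ffun 'I_d -> int} |
                 S (fun i => ((z i)%:~R / (k.+1)%:R)%R)]) 1)%E.

Definition has_volume (R : realType) (d : nat) (S : set ('I_d -> R)) (v : R)
  : Prop :=
  (fun k : nat => (grid_count S k * ((k.+1)%:R ^- d)%:E)%E) @ \oo --> v%:E.

(* normalized volume of P in the affine lattice L (convention: a unimodular
   d-simplex has volume 1/d!): the volume of the preimage of P under the
   affine coordinate map given by any affine lattice basis of L. *)
Definition has_normalized_volume (R : realType) (n : nat) (P L : set 'M[R]_n)
  (v : R) : Prop :=
  forall (d : nat) (p : 'M[R]_n) (b : 'I_d -> 'M[R]_n),
    affine_lattice_basis L p b ->
    has_volume [set t | P (aff_comb p b t)] v.

Definition frobenius_complement (gT : finGroupType) (G H : {group gT}) : Prop :=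
  H \proper G /\
  (forall x, x \in G -> x \notin H -> (H :&: (H :^ x^-1))%g = 1%g).

Definition frobenius_kernel (n : nat) (G : {set {perm 'I_n}}) : {set {perm 'I_n}} :=
  [set g in G | (g == 1%g) || [forall i, g i != i]].

(* Main.v *)
Require Import Defs.
From HB Require Import structures.
From mathcomp Require Import all_boot all_order all_algebra all_fingroup.
From mathcomp Require Import all_solvable vcharacter.
From mathcomp Require Import all_classical all_reals all_analysis.
From mathcomp Require Import zify ring.
Import Order.TTheory GRing.Theory Num.Theory.
Local Open Scope ring_scope.
Set Implicit Arguments. Unset Strict Implicit. Unset Printing Implicit Defensive.

(* Write h = |H| and k = |N| = n. The matrices of each coset of N sum to the
   all-ones matrix, and these h - 1 coincidences generate all linear relations
   between the vertices: P(G) is a free sum of h simplices of dimension k - 1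
   glued at their barycenters. Subtracting from the coefficients on each coset
   but one their minimum gives every lattice point of m P(G) unique natural
   coefficients of sum m that vanish somewhere on each of these h - 1 cosets.
   Sorting them by the position of the first zero in each such coset, there are
   k^(h-1) families, each of asymptotic size m^(hk-h) / (hk-h)!, hence the volume
   k^(h-1) / (hk-h)!. The alternating sum of the theorem equals k^(h-1). *)

(** * The alternating sum *)

Lemma coef_add1Xn (R : comNzRingType) (m i : nat) :
  ((1 + 'X : {poly R}) ^+ m)`_i = 'C(m, i)%:R.
Proof.
rewrite exprDn coef_sum.
under eq_bigr do rewrite expr1n mul1r coefMn coefXn.
case: (ltnP i m.+1) => him.
  rewrite (bigD1 (Ordinal him)) //= eqxx big1 ?addr0 // => j hj.
  rewrite (_ : (i == j) = false) ?mul0rn //.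
  by apply/negbTE; apply: contra hj => /eqP e; apply/eqP/val_inj.
rewrite bin_small // big1 // => j _.
by rewrite gtn_eqF ?mul0rn // (leq_trans (ltn_ord j)).
Qed.

(* The left-hand side is the coefficient of [X ^ m] in
   [(1 + X) ^ k * ((1 + X) ^ k - 1) ^ m], and [X] divides [(1 + X) ^ k - 1]. *)
Lemma sum_sign_bin_mul_bin (R : comNzRingType) (m k : nat) :
  \sum_(l < m.+1) ('C((m.+1 - l) * k, m)%:R * 'C(m, l)%:R * (-1) ^+ l) =
  (k ^ m)%:R :> R.
Proof.
pose P : {poly R} := (1 + 'X) ^+ k.
have -> : \sum_(l < m.+1) ('C((m.+1 - l) * k, m)%:R * 'C(m, l)%:R * (-1) ^+ l)
   = (P * (P - 1) ^+ m)`_m :> R.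
  rewrite exprDn mulr_sumr coef_sum; apply: eq_bigr => l _.
  rewrite [in RHS]mulrnAr [in RHS]mulrA -exprS -subSn -1?ltnS // /P -exprM mulnC coefMn.
  have -> : (-1) ^+ l = ((-1) ^+ l)%:P :> {poly R} by rewrite rmorphXn rmorphN.
  by rewrite coefMC coef_add1Xn -[RHS]mulr_natr mulrAC.
have [q hq] : exists q : {poly R}, P - 1 = q * 'X.
  exists (\poly_(i < k) P`_i.+1); apply/polyP => -[|i].
    by rewrite coefB coefMX coef1 coef_add1Xn bin0 subrr.
  rewrite coefB coefMX coef1 subr0 coef_poly /=; case: ltnP => // hi.
  by rewrite coef_add1Xn bin_small.
have q0 : q`_0 = k%:R.
  move: (congr1 (fun p : {poly R} => p`_1) hq).
  by rewrite coefMX coefB coef1 subr0 coef_add1Xn bin1.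
(* The coefficient of [X ^ m] in [P * q ^ m * X ^ m] is [P(0) * q(0) ^ m], where [P(0) = 1] and
   [q(0) = k]. *)
rewrite hq exprMn mulrA coefMXn ltnn subnn -!horner_coef0 hornerM horner_exp.
rewrite hornerD hornerX -polyC1 hornerC addr0 expr1n mul1r horner_exp.
by rewrite horner_coef0 q0 natrX.
Qed.

(** Since [h < k], the number [(h (k - 1) - 1) / k = h - (h + 1) / k] lies in [[h - 1, h)], so [l]
    runs up to [h - 1]; symmetry of the binomial coefficients then reduces the sum to the previous
    identity with [m = h - 1]. *)
Lemma frobenius_alternating_sum (R : realType) (h k : nat) : (0 < h)%N -> (h < k)%N ->
 \sum_(0 <= l < ((h * (k - 1) - 1) %/ k).+1)
   ('C((h - l) * k, (h - l) * k - h + 1)%:R * 'C(h - 1, l)%:R * (-1) ^+ l)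
 = (k ^ (h - 1))%:R :> R.
Proof.
case: h => // m _ hk.
have -> : ((m.+1 * (k - 1) - 1) %/ k = m)%N.
  apply/eqP; rewrite eqn_leq -ltnS ltn_divLR ?leq_divRL; nia.
rewrite subn1 /= -sum_sign_bin_mul_bin big_mkord; apply: eq_bigr => l _.
congr (_%:R * _ * _).
have := ltn_ord l => hl.
(* With [m.+1 < k], this makes the truncated difference [(m.+1 - l) * k - m.+1] exact. *)
have : (k <= (m.+1 - l) * k)%N by rewrite leq_pmull // subn_gt0.
move: (_ * k)%N => x hx.
by rewrite -bin_sub ?leq_subr; [congr 'C(_, _); lia | lia].
Qed.

(** * Linear relations between the elements of a Frobenius group *)

(* [frobenius_kernel] only singles out a set; that it is a group is Frobenius's theorem. *)
Lemma frobenius_kernel_group (n : nat) (G H : {group {perm 'I_n}}) (a : 'I_n) :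
  [transitive G, on [set: 'I_n] | 'P]%g ->
  H = 'C_G[a | 'P]%G :> {set _} ->
  frobenius_complement G H ->
  exists K : {group {perm 'I_n}},
    [/\ frobenius_kernel G = K, #|K| = n, (#|H| < #|K|)%N,
      #|G| = (#|K| * #|H|)%N &
      forall g i j, g \in G -> g i = i -> g j = j -> i != j -> g = 1%g].
Proof.
move=> trG defH [prHG tiH].
have cardG : #|G| = (n * #|H|)%N.
  have := card_orbit_stab 'P G a.
  by rewrite (atransP trG) ?finset.in_setT // cardsT card_ord -defH => <-.
have sHG : H \subset G by exact: proper_sub.
have fixH g : g \in G -> (g \in H) = (g a == a).
  by move=> gG; rewrite defH finset.in_setI gG /=; apply/(sameP astab1P)/eqP.
have toA i : exists2 x, x \in G & x a = i.
  have [||x xG ->] := atransP2 trG (x := a) (y := i); rewrite ?finset.in_setT //.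
  by exists x.
(* The stabilizers of [i = x a] and [j = y a] are conjugates of [H]; as [i] and [j] differ, they
   meet trivially. *)
have fix1 g i j : g \in G -> g i = i -> g j = j -> i != j -> g = 1%g.
  move=> gG gi gj nij.
  have [x xG xa] := toA i; have [y yG ya] := toA j.
  have gxH : (g ^ x^-1)%g \in H.
    by rewrite fixH ?groupJ ?groupV // /conjg !permM invgK xa gi -xa permK.
  have gyH : (g ^ y^-1)%g \in H.
    by rewrite fixH ?groupJ ?groupV // /conjg !permM invgK ya gj -ya permK.
  have nyx : (y * x^-1)%g \notin H.
    rewrite fixH ?groupM ?groupV // permM ya; apply: contra nij => /eqP e.
    by rewrite -xa -e permKV.
  have : (g ^ y^-1)%g \in (H :&: (H :^ (y * x^-1)^-1))%g.
    by rewrite finset.in_setI gyH mem_conjg invgK -conjgM mulgA mulVg mul1g.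
  rewrite (tiH _ (groupM yG (groupVr xG)) nyx) set1gE finset.in_set1.
  by rewrite conjg_eq1 => /eqP.
suff [K [sKG KH cK]] : exists K : {group {perm 'I_n}}, [/\ K \subset G,
    forall g, g \in G -> (g \in K) = (g == 1%g) || [forall i, g i != i]
    & #|K| = n /\ (#|H| < n)%N].
  case: cK => cK Hn; exists K; split; rewrite ?cK //.
  apply/setP => g; rewrite finset.inE.
  by case: (boolP (g \in G)) => [/KH ->|/(contra (fintype.subsetP sKG g))/negbTE].
(* Frobenius's theorem is applied below to a nontrivial complement only. If [H] is trivial, the
   action is regular and the kernel is all of [G]. *)
have [H1|ntH] := eqsVneq H 1%g.
  exists G; split=> // [g gG|].
    rewrite gG; apply/esym; case: eqP => //= ng1; apply/forallP => i.
    apply/eqP => gi; have [x xG xa] := toA i.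
    have : (g ^ x^-1)%g \in H.
      by rewrite fixH ?groupJ ?groupV // /conjg !permM invgK xa gi -xa permK.
    by rewrite H1 set1gE finset.in_set1 conjg_eq1 => /eqP.
  have := proper_card prHG.
  by rewrite cardG H1 cards1 muln1.
have frobH : [Frobenius G with complement H]%g.
  rewrite /Frobenius_group_with_complement (proper_neq prHG) /=.
  apply/normedTI_P; split; first by rewrite finset.setD_eq0 subG1.
    by rewrite finset.subsetI sHG normD1 normG.
  move=> g gG; apply: contraR => ngH; apply/pred0P => y /=; apply/negbTE.
  rewrite conjD1g !finset.in_setD1; apply/negP.
  move=> /andP[/andP[y1 yH] /andP[_ yHg]].
  have := tiH (g^-1)%g (groupVr gG); rewrite groupV invgK => /(_ ngH) /setP/(_ y).
  by rewrite finset.in_setI yH yHg set1gE finset.in_set1 (negbTE y1).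
have [K frobK] := Frobenius_kernel_exists frobH.
have [/sdprodP[_ defG nKH tiKH] ntK _ prKG _] := Frobenius_context frobK.
have sKG := proper_sub prKG.
have nsKG : normal K G by rewrite /normal sKG -defG mulG_subG normG nKH.
have cK : #|K| = n.
  apply/eqP; rewrite -(eqn_pmul2r (cardG_gt0 H)) -cardG -defG.
  by rewrite TI_cardMg.
(* Point stabilizers are conjugates of [H], and the normal subgroup [K] meets each of them
   trivially. *)
have Kfree i y : y \in K -> y i = i -> y = 1%g.
  move=> yK yi; have [x xG xa] := toA i.
  have yG := fintype.subsetP sKG _ yK.
  have : (y ^ x^-1)%g \in (K :&: H)%g.
    rewrite finset.in_setI memJ_norm ?yK; last first.
      by rewrite groupV (fintype.subsetP (normal_norm nsKG)).
    by rewrite /= fixH ?groupJ ?groupV // /conjg !permM invgK xa yi -xa permK.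
  by rewrite tiKH set1gE finset.in_set1 conjg_eq1 => /eqP.
exists K; split=> //.
  move=> g gG; apply/idP/idP.
    move=> gK; case: eqP => //= ng1; apply/forallP => i; apply/eqP => gi.
    by case: ng1; apply: Kfree gi.
  move=> /orP[/eqP->|/forallP gfree]; first exact: group1.
  (* [G] is the disjoint union of [K] and the conjugates of [H] by elements [x] of [K], deprived of
     the identity; the conjugate by [x] fixes [x a]. *)
  have := cover_partition (Frobenius_partition frobK) => /setP/(_ g).
  rewrite gG => /bigcupP[B]; rewrite finset.in_setU1 => /orP[/eqP->//|].
  move=> /imsetP[x xK ->]; rewrite mem_conjg finset.in_setD1 => /andP[_].
  have xG := fintype.subsetP sKG _ xK.
  rewrite fixH ?groupJ ?groupV // /conjg !permM invgK => /eqP e.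
  by case/eqP: (gfree (x a)); rewrite -[in RHS]e permKV.
split=> //.
(* The order of [H] divides [#|K| - 1], which is positive. *)
have : (1 < #|K|)%N by rewrite cardG_gt1.
by have := dvdn_leq _ (Frobenius_dvd_ker1 frobK); rewrite cK; lia.
Qed.

(** Summing the entries [(i, g0 i)] of the relation weights [c g] by the number of fixed points of
    [g * g0^-1]: [n] if [g = g0], 0 for the other elements of [K g0], and 1 outside this coset. So
    [n * c g0] is minus the sum of [c] outside [K g0], which depends on the coset only. *)
Lemma pmat_relation (R : realType) (n : nat) (G K : {group {perm 'I_n}})
    (a : 'I_n) (c : {perm 'I_n} -> R) :
  frobenius_kernel G = K -> 
  (forall g i j, g \in G -> g i = i -> g j = j -> i != j -> g = 1%g) ->
  \sum_(g in G) c g *: pmat R g = 0 ->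
  forall g x, g \in G -> x \in K -> c (x * g)%g = c g.
Proof.
move=> defK fix1 rel.
have inK g : g \in G -> (g \in K) = (g == 1%g) || [forall i, g i != i].
  by move=> gG; rewrite -defK finset.inE gG.
have sKG : K \subset G.
  by rewrite -defK; apply/fintype.subsetP=> x; rewrite finset.inE => /andP[].
have fixn g : g \in G -> \sum_(i < n) (g i == i)%:R =
    (if g == 1%g then n%:R else if g \in K then 0 else 1) :> R.
  move=> gG; rewrite inK //; case: eqP => [->|ng1] /=.
    by under eq_bigr do rewrite perm1 eqxx; rewrite sumr_const card_ord.
  case: (boolP [forall i, g i != i]) => [/forallP fg|].
    by rewrite big1 // => i _; rewrite (negbTE (fg i)).
  move=> /forallPn[i]; rewrite negbK => /eqP gi.
  rewrite (bigD1 i) //= gi eqxx big1 ?addr0 // => j ji.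
  by case: eqP => // gj; case: ng1; apply: (fix1 g j i).
have key g0 : g0 \in G ->
    n%:R * c g0 + \sum_(g in G | (g * g0^-1)%g \notin K) c g = 0.
  move=> g0G.
  have : \sum_(i < n) (\sum_(g in G) c g *: pmat R g) i (g0 i) = 0.
    by rewrite rel big1 // => i _; rewrite mxE.
  under eq_bigr do rewrite summxE.
  rewrite exchange_big /= => rel0; rewrite -[RHS]rel0 {rel0}.
  rewrite [RHS](bigD1 g0) //=.
  congr (_ + _).
    rewrite [RHS](eq_bigr (fun=> c g0)) => [|i _].
      by rewrite sumr_const card_ord mulr_natl.
    by rewrite !mxE eqxx mulr1.
  rewrite [LHS]big_mkcondr [RHS]big_mkcondr /=; apply: eq_bigr => g gG.
  have -> : \sum_(i < n) (c g *: pmat R g) i (g0 i) =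
     c g * \sum_(i < n) ((g * g0^-1)%g i == i)%:R.
    rewrite mulr_sumr; apply: eq_bigr => i _; rewrite !mxE permM.
    by congr (_ * _%:R); rewrite -[in RHS](inj_eq (@perm_inj _ g0)) permKV.
  have eq1 : ((g * g0^-1)%g == 1%g) = (g == g0).
    by apply/eqP/eqP => [e|->]; rewrite ?mulgV // -(mulgKV g0 g) e mul1g.
  rewrite fixn ?eq1; last exact: groupM gG (groupVr g0G).
  case: eqP => [->|_] /=; first by rewrite mulgV group1.
  by case: (_ \in K); rewrite /= ?mulr0 ?mulr1.
move=> g x gG xK; have xG := fintype.subsetP sKG _ xK.
have n0 : (n%:R : R) != 0.
  by rewrite pnatr_eq0 -lt0n (leq_ltn_trans _ (ltn_ord a)).
apply: (mulfI n0); apply: (addIr (\sum_(g' in G | (g' * g^-1)%g \notin K) c g')).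
rewrite key // -[RHS](key (x * g)%g) ?groupM //; congr (_ + _).
apply: eq_bigl => y; case: (y \in G) => //=.
by rewrite invMg mulgA [in RHS]groupMr ?groupV.
Qed.

(** A free action of [n] elements on [n] points is simply transitive, so each entry is 1 in exactly
    one summand. *)
Lemma sum_pmat_coset (R : realType) (n : nat) (K : {group {perm 'I_n}})
    (x : {perm 'I_n}) :
  #|K| = n -> (forall y i, y \in K -> y i = i -> y = 1%g) ->
  \sum_(y in K) pmat R (y * x)%g = const_mx 1.
Proof.
move=> cK freeK; apply/matrixP => i j; rewrite summxE mxE.
have injK : {in K &, injective (fun y : {perm 'I_n} => y i)}.
  move=> y z yK zK eyz; apply/eqP; rewrite eq_mulgV1; apply/eqP.
  by apply: (freeK _ i); rewrite ?groupM ?groupV // permM eyz permK.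
have imK : [set (y : {perm 'I_n}) i | y in K]%SET = [set: 'I_n].
  by apply/eqP; rewrite eqEcard finset.subsetT cardsT card_ord card_in_imset // cK leqnn.
transitivity (\sum_(y in K) ((y : {perm 'I_n}) i == x^-1%g j)%:R : R).
  apply: eq_bigr => y _; rewrite mxE permM.
  by rewrite -[in RHS](inj_eq (@perm_inj _ x)) permKV.
rewrite -(big_imset (fun l => (l == x^-1%g j)%:R)) //= imK.
rewrite (bigD1 (x^-1%g j)) ?finset.in_setT //= eqxx big1 ?addr0 // => l.
by move=> /andP[_ /negbTE->].
Qed.

(** The blocks are the cosets [K x] with [x] in [H]. Relations are constant on blocks, and each
    block sums to the all-ones matrix, so the only further condition is that the block constants add
    up to 0. *)
Lemma frobenius_configuration (R : realType) (n h k : nat)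
    (G H K : {group {perm 'I_n}}) (a : 'I_n) :
  frobenius_kernel G = K -> #|K| = n ->
  (forall g i j, g \in G -> g i = i -> g j = j -> i != j -> g = 1%g) ->
  H = 'C_G[a | 'P]%G :> {set _} ->
  #|G| = (#|K| * #|H|)%N ->
  #|H| = h.+1 -> #|K| = k.+1 ->
  exists f : 'I_h.+1 * 'I_k.+1 -> {perm 'I_n},
    [/\ injective f, [set f q | q in [set: 'I_h.+1 * 'I_k.+1]]%SET = G &
    forall c : 'I_h.+1 * 'I_k.+1 -> R, \sum_q c q *: pmat R (f q) = 0 <->
      exists r : 'I_h.+1 -> R, \sum_i r i = 0 /\ forall q, c q = r q.1].
Proof.
move=> defK cKn fix1 defH cardG cH cK.
have sKG : K \subset G.
  by rewrite -defK; apply/fintype.subsetP=> x; rewrite finset.inE => /andP[].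
have sHG : H \subset G by rewrite defH subsetIl.
have freeK y i : y \in K -> y i = i -> y = 1%g.
  rewrite -defK finset.inE => /andP[_ /orP[/eqP->//|/forallP yf]] yi.
  by case/eqP: (yf i).
have fixH x : x \in H -> x a = a.
  by rewrite defH finset.in_setI => /andP[_ /astab1P].
pose y_ (j : 'I_k.+1) : {perm 'I_n} := enum_val (cast_ord (esym cK) j).
pose x_ (i : 'I_h.+1) : {perm 'I_n} := enum_val (cast_ord (esym cH) i).
have yK j : y_ j \in K by exact: enum_valP.
have xH i : x_ i \in H by exact: enum_valP.
pose f (q : 'I_h.+1 * 'I_k.+1) := (y_ q.2 * x_ q.1)%g.
have injf : injective f.
  move=> [i j] [i' j']; rewrite /f /= => e.
  (* This element lies in both [K] and [H]: it fixes [a], hence is trivial. *)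
  have e2 : ((y_ j')^-1 * y_ j = x_ i' * (x_ i)^-1)%g.
    by rewrite -[y_ j](mulgK (x_ i)) e !mulgA mulVg mul1g.
  have e1 : ((y_ j')^-1 * y_ j)%g = 1%g.
    apply: (freeK _ a); first by rewrite groupM ?groupV.
    by rewrite e2 permM fixH //; apply: (canLR (permK _)); rewrite fixH.
  have ej : y_ j = y_ j' by rewrite -[RHS]mulg1 -e1 mulKVg.
  have ei : x_ i = x_ i' by move: e; rewrite ej => /mulgI.
  by move/enum_val_inj/cast_ord_inj: ei => ->; move/enum_val_inj/cast_ord_inj: ej => ->.
have imf : [set f q | q in [set: 'I_h.+1 * 'I_k.+1]]%SET = G.
  apply/eqP; rewrite eqEcard card_imset // cardsT card_prod !card_ord cardG cH cK.
  rewrite mulnC leqnn andbT; apply/fintype.subsetP => _ /imsetP[q _ ->].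
  by apply: groupM; [apply: (fintype.subsetP sKG) | apply: (fintype.subsetP sHG)].
have sumJ (r : 'I_h.+1 -> R) :
    \sum_q r q.1 *: pmat R (f q) = (\sum_i r i) *: const_mx 1.
  rewrite -(pair_bigA _ (fun i j => r i *: pmat R (f (i, j)))) /= scaler_suml.
  apply: eq_bigr => i _; rewrite -scaler_sumr -(sum_pmat_coset R (x_ i) cKn) //.
  congr (_ *: _); rewrite [RHS](big_enum_val) /= .
  rewrite [RHS](reindex (cast_ord (esym cK))) //.
  by apply: onW_bij; exists (cast_ord cK); [exact: cast_ordKV | exact: cast_ordK].
exists f; split=> // c; split=> [rel|[r [r0 cr]]]; last first.
  by under eq_bigr do rewrite cr; rewrite sumJ r0 scale0r.
pose c' g := if [pick q | f q == g] is Some q then c q else 0.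
have c'f q : c' (f q) = c q.
  by rewrite /c'; case: pickP => [q' /eqP/injf->//|/(_ q)]; rewrite eqxx.
have /pmat_relation cK' : \sum_(g in G) c' g *: pmat R g = 0.
  rewrite -imf big_imset /=; last by move=> ? ? _ _; exact: injf.
  by rewrite -[RHS]rel; apply: eq_big => [q|q _]; rewrite ?finset.in_setT ?c'f.
(* Both coefficients equal the one of the coset representative [x_ q.1]. *)
have cr q : c q = c (q.1, ord0).
  have xG i := fintype.subsetP sHG _ (xH i).
  by rewrite -!c'f /f !(cK' K a).
exists (fun i => c (i, ord0)); split=> //.
move: rel; under eq_bigr do rewrite cr.
by rewrite (sumJ (fun i => c (i, ord0))) => /matrixP/(_ a a); rewrite !mxE mulr1.
Qed.

(** * Vectors with a zero in each block *)

(** Stars and bars: the bound [m] only makes the type of functions finite, and excludes nothing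
    because [N <= m]. *)
Lemma card_bounded_compositions (K : finType) (d m N : nat) :
  #|K| = d.+1 -> (N <= m)%N ->
  #|[set t : {ffun K -> 'I_m.+1} | (\sum_x t x == N)%N]%SET| = 'C(N + d, d).
Proof.
move=> cK leNm; rewrite addnC -card_ord_partitions.
pose rk (x : K) : 'I_d.+1 := cast_ord cK (enum_rank x).
have rkB : bijective rk.
  exists (fun i => enum_val (cast_ord (esym cK) i)) => x.
    by rewrite /rk cast_ordK enum_rankK.
  by rewrite /rk enum_valK cast_ordKV.
pose F (t : d.+1.-tuple 'I_N.+1) : {ffun K -> 'I_m.+1} :=
  [ffun x => inord (tnth t (rk x))].
have FE t x : F t x = tnth t (rk x) :> nat.
  by rewrite ffunE inordK // ltnS (leq_trans _ leNm) // -ltnS.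
have injF : injective F.
  move=> t u e; apply: eq_from_tnth => i; have [rk' _ rkK] := rkB.
  by apply/val_inj; rewrite /= -[i]rkK -!FE e.
have sumF t : (\sum_x F t x = \sum_(i <- t) i)%N.
  rewrite big_tuple (reindex rk) /=; last exact: onW_bij.
  by apply: eq_bigr => x _; rewrite FE.
rewrite -(card_imset _ injF); apply: eq_card => t; rewrite !inE.
apply/eqP/imsetP => [sumt|[u]]; last by rewrite inE => /eqP <- ->; rewrite sumF.
have [rk' rk'K rkK] := rkB.
have let_ i : (t (rk' i) <= N)%N.
  by rewrite -sumt (bigD1 (rk' i)) //= leq_addr.
pose u := [tuple inord (t (rk' i)) : 'I_N.+1 | i < d.+1].
have Fu : F u = t.
  apply/ffunP => x; apply/val_inj; rewrite /= FE tnth_mktuple inordK ?ltnS //.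
  by rewrite rk'K.
by exists u; rewrite // inE -sumF Fu sumt.
Qed.

Lemma sum_nat_ltn (k s : nat) : (\sum_(j < k) (j < s) = minn s k)%N.
Proof.
elim: k => [|k IH]; first by rewrite big_ord0 minn0.
by rewrite big_ord_recr /= IH; case: ltnP => /=; lia.
Qed.

(* A vector on [h.+1] blocks of size [k.+1] that has a zero in each block but
   the first is encoded by the positions [st.1] of the first zeros, and by its
   other coordinates [st.2], those before the first zero being lowered by 1. *)
Definition zcode (h k m : nat) : finType :=
  ({ffun 'I_h -> 'I_k.+1} * {ffun 'I_k.+1 + 'I_h * 'I_k -> 'I_m.+1})%type.

Definition zvec (h k m : nat) (st : zcode h k m)
    (q : 'I_h.+1 * 'I_k.+1) : nat :=
  if unlift ord0 q.1 is Some i then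
    if unlift (st.1 i) q.2 is Some j then st.2 (inr (i, j)) + (j < st.1 i) else 0
  else st.2 (inl q.2).

Definition zcodes (h k m : nat) : {set zcode h k m} :=
  [set st : zcode h k m | (\sum_i st.1 i + \sum_x st.2 x == m)%N]%SET.

Section Codes.
Variables h k m : nat.
Implicit Types st : zcode h k m.

Lemma zvec0 st j : zvec st (ord0, j) = st.2 (inl j).
Proof. by rewrite /zvec unlift_none. Qed.

Lemma zvec_zero st i : zvec st (lift ord0 i, st.1 i) = 0%N.
Proof. by rewrite /zvec liftK unlift_none. Qed.

Lemma zvec_lift st i j :
  zvec st (lift ord0 i, lift (st.1 i) j) = (st.2 (inr (i, j)) + (j < st.1 i))%N.
Proof. by rewrite /zvec !liftK. Qed.

(** This makes [st.1 i] the position of the first zero of its block, so that the vector determines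
    it. *)
Lemma zvec_before st i (j : 'I_k.+1) :
  (j < st.1 i)%N -> (0 < zvec st (lift ord0 i, j))%N.
Proof.
case: (unliftP (st.1 i) j) => [j' ->|->]; last by rewrite ltnn.
rewrite zvec_lift /= /bump; case: (ltnP j' (st.1 i)) => [_|le_sj].
  by rewrite addn1.
by rewrite add1n ltnNge (leqW le_sj).
Qed.

(** In a block whose first zero is at position [s], exactly [s] coordinates were lowered by 1. *)
Lemma sum_zvec st : (\sum_q zvec st q = \sum_i st.1 i + \sum_x st.2 x)%N.
Proof.
rewrite -(pair_bigA _ (fun i j => zvec st (i, j))) /= big_ord_recl.
under eq_bigr do rewrite zvec0.
rewrite big_sumType /= addnCA; congr addn.
have -> : (\sum_p st.2 (inr p) = \sum_i \sum_j st.2 (inr (i, j)))%N.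
  by rewrite pair_bigA; apply: eq_bigr => -[].
rewrite -big_split.
apply: eq_bigr => i _ /=; rewrite (bigD1_ord (st.1 i)) //= zvec_zero add0n.
under eq_bigr do rewrite zvec_lift.
rewrite big_split sum_nat_ltn addnC /=; congr addn.
by apply/minn_idPl; rewrite -ltnS.
Qed.

Lemma zvec_inj : injective (@zvec h k m).
Proof.
move=> st st' /funeqP eqd.
have eqs : st.1 = st'.1.
  apply/ffunP => i; case: (ltngtP (st.1 i) (st'.1 i)) => [||/ord_inj//].
    by move=> /zvec_before; rewrite -eqd zvec_zero.
  by move=> /zvec_before; rewrite eqd zvec_zero.
case: st st' eqs eqd => s t [s' t'] /= <- eqd; congr (_, _).
apply/ffunP => -[j|[i j]]; apply/val_inj.
  by have := eqd (ord0, j); rewrite !zvec0.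
by have := eqd (lift ord0 i, lift (s i) j); rewrite !(zvec_lift (s, _)) => /addIn.
Qed.

Lemma zvec_surj (w : 'I_h.+1 * 'I_k.+1 -> nat) :
  (\sum_q w q)%N = m -> (forall i, i != ord0 -> exists j, w (i, j) = 0%N) ->
  exists2 st, st \in zcodes h k m & zvec st = w.
Proof.
move=> sumw w0.
have lew q : (w q <= m)%N by rewrite -sumw (bigD1 q) //= leq_addr.
have /choice[s sP] : forall i : 'I_h, exists si : 'I_k.+1,
    w (lift ord0 i, si) = 0%N /\ forall j, w (lift ord0 i, j) = 0%N -> (si <= j)%N.
  move=> i.
  have [j0 /eqP wj0] := w0 (lift ord0 i) (negbT (lift_eqF _ _)).
  case: (arg_minnP (P := fun j => w (lift ord0 i, j) == 0%N) (@nat_of_ord _) wj0).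
  by move=> j /eqP wj jmin; exists j; split=> // j' /eqP; apply: jmin.
(* [inord] loses nothing since every coordinate is at most [m], nor does the truncated subtraction,
   since the coordinates before the first zero are positive. *)
pose st : zcode h k m :=
  ([ffun i => s i], [ffun x => match x with
    | inl j => inord (w (ord0, j))
    | inr (i, j) => inord (w (lift ord0 i, lift (s i) j) - (j < s i))
    end]).
have dst : zvec st = w.
  apply/funext => -[i j]; case: (unliftP ord0 i) => [i' ->|->].
    case: (unliftP (st.1 i') j) => [j' ->|->].
      rewrite zvec_lift !ffunE inordK ?ltnS ?(leq_trans (leq_subr _ _)) // subnK //.
      case: ltnP => // ltj; rewrite lt0n; apply/eqP => /(proj2 (sP i')).
      by rewrite /= /bump (leqNgt (s i') j') ltj add0n leqNgt ltj.
    by rewrite zvec_zero ffunE (proj1 (sP i')).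
  by rewrite zvec0 ffunE inordK ?ltnS.
by exists st; rewrite // inE -sum_zvec dst sumw.
Qed.

End Codes.

(** For fixed zero positions [s], the [h.+1 * k + 1] free coordinates have sum [m - \sum_i s i]; the
    bound on [m] keeps this difference exact for every [s]. *)
Lemma card_zcodes (h k m : nat) : (h * k <= m)%N ->
  #|zcodes h k m| =
  \sum_(s : {ffun 'I_h -> 'I_k.+1}) 'C(m - \sum_i s i + h.+1 * k, h.+1 * k).
Proof.
move=> lem.
pose Q (s : {ffun 'I_h -> 'I_k.+1}) (t : {ffun 'I_k.+1 + 'I_h * 'I_k -> 'I_m.+1}) :=
  (\sum_i s i + \sum_x t x == m)%N.
rewrite -sum1_card (eq_bigl (fun st => predT st.1 && Q st.1 st.2)) => [|st]; last first.
  by rewrite inE.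
rewrite -(pair_big_dep predT Q (fun _ _ => 1%N)) /=.
apply: eq_bigr => s _.
have les : (\sum_i s i <= m)%N.
  apply: leq_trans lem; rewrite -[X in (_ <= X * _)%N]card_ord -sum_nat_const.
  by apply: leq_sum => i _; rewrite -ltnS.
rewrite -(@card_bounded_compositions ('I_k.+1 + 'I_h * 'I_k)%type _ m);
  last exact: leq_subr.
  rewrite -sum1_card; apply: eq_bigl => t; rewrite inE.
  by rewrite /Q -[in RHS](eqn_add2l (\sum_i s i)) subnKC.
by rewrite card_sum card_prod !card_ord; lia.
Qed.

(** * Lattice points of a free sum of simplices *)

Section LatticeRank.
Variables (R : realType) (V : lmodType R).

(** The integer matrices expressing each family in the other satisfy [Y *m Z = 1] by independence of
    [b], which bounds the size of [Y *m Z] by the inner dimension. *)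
Lemma lattice_rank_le (d e : nat) (b : 'I_d -> V) (u : 'I_e -> V) :
  (forall i, exists y : 'I_e -> int, b i = \sum_j (y j)%:~R *: u j) ->
  (forall j, exists z : 'I_d -> int, u j = \sum_i (z i)%:~R *: b i) ->
  (forall z : 'I_d -> int, \sum_i (z i)%:~R *: b i = 0 -> forall i, z i = 0) ->
  (d <= e)%N.
Proof.
move=> /choice[y yP] /choice[z zP] indep.
pose Y : 'M[int]_(d, e) := \matrix_(i, j) y i j.
pose Z : 'M[int]_(e, d) := \matrix_(j, i) z j i.
suff YZ : Y *m Z = 1%:M by exact: mulmx1_min YZ.
apply/matrixP => i i'; apply/eqP; rewrite -subr_eq0; apply/eqP.
apply: (indep (fun i' => (Y *m Z) i i' - 1%:M i i')).
under eq_bigr do rewrite rmorphB scalerBl.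
rewrite sumrB; apply/eqP; rewrite subr_eq0; apply/eqP.
transitivity (b i); last first.
  rewrite (bigD1 i) //= mxE eqxx scale1r big1 ?addr0 // => j ji.
  by rewrite mxE eq_sym (negbTE ji) scale0r.
rewrite yP; under [RHS]eq_bigr do rewrite zP scaler_sumr.
rewrite exchange_big; apply: eq_bigr => i1 _ /=.
rewrite mxE rmorph_sum scaler_suml; apply: eq_bigr => j _ /=.
by rewrite !mxE rmorphM scalerA.
Qed.

End LatticeRank.

Section FreeSum.
Variables (R : realType) (n h k : nat) (v : 'I_h.+1 * 'I_k.+1 -> 'M[R]_n).

(** Equivalently, all blocks have the same sum [\sum_j v (i, j)], and these coincidences span the
    linear relations. *)
Definition free_sum_relations : Prop := forall c : 'I_h.+1 * 'I_k.+1 -> R,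
  \sum_q c q *: v q = 0 <->
  exists r : 'I_h.+1 -> R, \sum_i r i = 0 /\ forall q, c q = r q.1.

Definition point_lattice : set 'M[R]_n :=
  [set M | exists c : 'I_h.+1 * 'I_k.+1 -> int,
      \sum_q c q = 1 /\ M = \sum_q (c q)%:~R *: v q]%classic.

Definition point_polytope : set 'M[R]_n :=
  [set M | exists lam : 'I_h.+1 * 'I_k.+1 -> R,
      (forall q, 0 <= lam q) /\ \sum_q lam q = 1 /\
      M = \sum_q lam q *: v q]%classic.

Hypothesis relv : free_sum_relations.
Variables (d : nat) (p : 'M[R]_n) (b : 'I_d -> 'M[R]_n).
Hypothesis basisb : affine_lattice_basis point_lattice p b.

Lemma basis_point : exists c : 'I_h.+1 * 'I_k.+1 -> int,
  \sum_q c q = 1 /\ p = \sum_q (c q)%:~R *: v q.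
Proof.
have [/(_ p) [_ H] _] := basisb; apply: H; exists (fun=> 0).
by rewrite /aff_comb big1 ?addr0 // => i _; rewrite scale0r.
Qed.

Lemma basis_vector i : exists c : 'I_h.+1 * 'I_k.+1 -> int,
  \sum_q c q = 0 /\ b i = \sum_q (c q)%:~R *: v q.
Proof.
have [cp [cp1 pE]] := basis_point.
have [/(_ (p + b i)) [_ H] _] := basisb.
have [|c [c1 pbE]] := H.
  exists (fun j => (j == i)%:R); rewrite /aff_comb (bigD1 i) //= eqxx scale1r.
  by rewrite big1 ?addr0 // => j /negbTE->; rewrite scale0r.
exists (fun q => c q - cp q); split; first by rewrite sumrB c1 cp1 subrr.
under eq_bigr do rewrite rmorphB scalerBl.
by rewrite sumrB -pbE -pE addrC addKr.
Qed.

(** Removing [m] times [p] leaves coefficient sum 0; adding [p] back once gives a lattice point, to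
    which the basis applies. *)
Lemma basis_span (m : int) (c : 'I_h.+1 * 'I_k.+1 -> int) : \sum_q c q = m ->
  exists z : 'I_d -> int,
    \sum_q (c q)%:~R *: v q = m%:~R *: p + \sum_i (z i)%:~R *: b i.
Proof.
move=> cm; have [cp [cp1 pE]] := basis_point.
have [/(_ (p + (\sum_q (c q)%:~R *: v q - m%:~R *: p))) [H _] _] := basisb.
have [|z /addrI zP] := H.
  exists (fun q => cp q + (c q - m * cp q)).
  rewrite big_split /= sumrB cm -mulr_sumr cp1 mulr1 subrr addr0; split=> //.
  under [RHS]eq_bigr do rewrite intrD intrB intrM scalerDl scalerBl -scalerA.
  by rewrite big_split /= sumrB -scaler_sumr -pE.
by exists z; rewrite -zP addrC subrK.
Qed.

Lemma basis_inj (z z' : 'I_d -> int) :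
  \sum_i (z i)%:~R *: b i = \sum_i (z' i)%:~R *: b i -> z = z'.
Proof.
move=> e; apply/funext => i; apply/eqP; rewrite -subr_eq0; apply/eqP; move: i.
have [_] := basisb; apply.
under eq_bigr do rewrite rmorphB scalerBl.
by rewrite sumrB e subrr.
Qed.

Lemma shift_coef (c : 'I_h.+1 * 'I_k.+1 -> int) (r : 'I_h.+1 -> int) :
  \sum_i r i = 0 ->
  \sum_q (c q - r q.1)%:~R *: v q = \sum_q (c q)%:~R *: v q.
Proof.
move=> r0; under eq_bigr do rewrite rmorphB scalerBl.
rewrite sumrB (_ : \sum_q (r q.1)%:~R *: v q = 0) ?subr0 //.
apply/relv; exists (fun i => (r i)%:~R); split=> //.
by rewrite -rmorph_sum r0.
Qed.

Lemma sum_shift_coef (c : 'I_h.+1 * 'I_k.+1 -> int) (r : 'I_h.+1 -> int) :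
  \sum_i r i = 0 -> \sum_q (c q - r q.1) = \sum_q c q.
Proof.
move=> r0; rewrite sumrB -(pair_bigA _ (fun i _ => r i)) /=.
under [X in _ - X]eq_bigr do rewrite sumr_const.
by rewrite sumrMnl r0 mul0rn subr0.
Qed.

(** Completes shifts prescribed on the other blocks to a relation: block [ord0] absorbs the
    total. *)
Definition balance (mu : 'I_h.+1 -> int) (i : 'I_h.+1) : int :=
  if i == ord0 then - \sum_(i' | i' != ord0) mu i' else mu i.

Lemma sum_balance mu : \sum_i balance mu i = 0.
Proof.
rewrite (bigD1 ord0) //= {1}/balance eqxx addrC; apply/eqP; rewrite subr_eq0.
by apply/eqP/eq_bigr => i /negbTE; rewrite /balance => ->.
Qed.

(** Dropping the point [(i, ord0)] of each block leaves [h.+1 * k] points; their differences with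
    [v o] form another integral basis of the direction lattice, so the two ranks agree. *)
Lemma basis_size : d = (h.+1 * k)%N.
Proof.
pose T := ('I_h.+1 * 'I_k)%type.
pose q_ (t : T) : 'I_h.+1 * 'I_k.+1 := (t.1, lift ord0 t.2).
pose o : 'I_h.+1 * 'I_k.+1 := (ord0, ord0).
have reindexT (F : 'I_h.+1 * 'I_k.+1 -> 'M[R]_n) :
    \sum_q F q = \sum_i F (i, ord0) + \sum_(t : T) F (q_ t).
  rewrite [LHS](eq_bigr (fun q => F (q.1, q.2))) => [|[] //].
  rewrite -(pair_bigA _ (fun i j => F (i, j))) /=.
  under eq_bigr do rewrite big_ord_recl.
  by rewrite big_split /= pair_bigA.
pose u (j : 'I_#|{: T}|) := v (q_ (enum_val j)) - v o.
have uE (y : T -> int) : \sum_(j < #|{: T}|) (y (enum_val j))%:~R *: u j =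
    \sum_(t : T) (y t)%:~R *: (v (q_ t) - v o).
  rewrite [RHS](reindex (@enum_val _ (mem {: T}))) //=.
  by apply: onW_bij; exact: enum_val_bij.
have b_u i : exists y : 'I_#|{: T}| -> int, b i = \sum_j (y j)%:~R *: u j.
  have [c [c0 ->]] := basis_vector i.
  (* This shift kills the coefficients at [(i, ord0)] for [i] nonzero; the one at [o] multiplies
     [v o - v o]. *)
  pose r := balance (fun i => c (i, ord0)); have r0 := sum_balance _ : \sum_i r i = 0.
  exists (fun j => c (q_ (enum_val j)) - r (q_ (enum_val j)).1).
  rewrite (uE (fun t => c (q_ t) - r (q_ t).1)) -(shift_coef c r0).
  transitivity (\sum_q (c q - r q.1)%:~R *: (v q - v o)).
    under [RHS]eq_bigr do rewrite scalerBr.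
    by rewrite sumrB -scaler_suml -rmorph_sum sum_shift_coef // c0 scale0r subr0.
  rewrite reindexT big1 ?add0r // => i' _; case: (eqVneq i' ord0) => [->|ni'] /=.
    by rewrite subrr scaler0.
  by rewrite /r /balance (negbTE ni') subrr scale0r.
have u_b j : exists z : 'I_d -> int, u j = \sum_i (z i)%:~R *: b i.
  have [|z] := @basis_span 0 (fun q => (q == q_ (enum_val j))%:R - (q == o)%:R).
    rewrite sumrB (bigD1 (q_ (enum_val j))) //= eqxx big1 => [|q /negbTE-> //].
    by rewrite (bigD1 o) // eqxx big1 => [|q /negbTE-> //]; rewrite !addr0 subrr.
  rewrite scale0r add0r => zP; exists z; rewrite -zP.
  under eq_bigr do rewrite rmorphB scalerBl.
  rewrite sumrB (bigD1 (q_ (enum_val j))) //= eqxx scale1r.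
  rewrite big1 => [|q /negbTE->]; last by rewrite scale0r.
  rewrite (bigD1 o) // eqxx scale1r big1 => [|q /negbTE->]; last by rewrite scale0r.
  by rewrite /= !addr0.
have indep_u (y : 'I_#|{: T}| -> int) :
    \sum_j (y j)%:~R *: u j = 0 -> forall j, y j = 0.
  pose y' t := y (enum_rank t); move=> yu0.
  have {}yu0 : \sum_t (y' t)%:~R *: (v (q_ t) - v o) = 0.
    rewrite -uE -[RHS]yu0; apply: eq_bigr => j _.
    by rewrite /y' enum_valK.
  (* Extended by 0 and corrected at [o], the coefficients form a relation that vanishes at
     [(i, ord0)] for [i] nonzero. Its block constants are thus 0 there, and on block [ord0] because
     their sum is 0. *)
  pose A (q : 'I_h.+1 * 'I_k.+1) : int :=
    if unlift ord0 q.2 is Some j then y' (q.1, j) else 0.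
  have A0 i : A (i, ord0) = 0 by rewrite /A unlift_none.
  have AE t : A (q_ t) = y' t by rewrite /A /= liftK; case: t.
  have /relv[r [r0 rE]] :
      \sum_q ((A q - (q == o)%:R * \sum_t y' t)%:~R : R) *: v q = 0.
    under eq_bigr do rewrite rmorphB scalerBl.
    rewrite sumrB reindexT big1 ?add0r => [|i _]; last by rewrite A0 scale0r.
    have -> : \sum_q ((q == o)%:R * \sum_t y' t)%:~R *: v q = (\sum_t y' t)%:~R *: v o.
      set s := (\sum_t y' t); rewrite (bigD1 o) // eqxx mul1r.
      rewrite big1 /= ?addr0 // => q /negbTE->.
      by rewrite mul0r scale0r.
    rewrite -[RHS]yu0 rmorph_sum scaler_suml -sumrB; apply: eq_bigr => t _.
    by rewrite AE scalerBr.
  have rn0 i : i != ord0 -> r i = 0.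
    move=> ni; rewrite -(rE (i, ord0)) A0 (_ : (_ == o) = false) ?mul0r ?subr0 //.
    by rewrite xpair_eqE (negbTE ni).
  have r_0 i : r i = 0.
    case: (eqVneq i ord0) => [->|/rn0//].
    by move: r0; rewrite (bigD1 ord0) //= big1 ?addr0.
  move=> j; rewrite -[j]enum_valK; set t := enum_val j.
  have := rE (q_ t); rewrite r_0 AE (_ : (_ == o) = false); last first.
    by rewrite xpair_eqE andbF.
  by rewrite mul0r subr0 => /eqP; rewrite intr_eq0 => /eqP.
have cT : #|{: T}| = (h.+1 * k)%N by rewrite card_prod !card_ord.
rewrite -cT; apply/eqP; rewrite eqn_leq.
rewrite (lattice_rank_le b_u u_b (proj2 basisb)).
by rewrite (lattice_rank_le u_b b_u indep_u).
Qed.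

Lemma comb_eq (c c' : 'I_h.+1 * 'I_k.+1 -> R) :
  \sum_q c q *: v q = \sum_q c' q *: v q ->
  exists r : 'I_h.+1 -> R, \sum_i r i = 0 /\ forall q, c q - c' q = r q.1.
Proof.
move=> e; apply/relv.
under eq_bigr do rewrite scalerBl.
by rewrite sumrB e subrr.
Qed.

(** The two vectors differ by a constant [r i] on each block. For [i] nonzero, the zero of the first
    vector gives [r i <= 0] and that of the second [r i >= 0]; then [r ord0 = 0] as well. *)
Lemma comb_zvec_inj m (st st' : zcode h k m) :
  \sum_q (zvec st q)%:R *: v q = \sum_q (zvec st' q)%:R *: v q -> st = st'.
Proof.
move=> /comb_eq[r [r0 rE]]; apply: zvec_inj; apply/funext => q.
have rn0 i : i != ord0 -> r i = 0.
  case: (unliftP ord0 i) => [i' ->|->]; rewrite ?eqxx // => _.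
  apply/le_anti/andP; split.
    by rewrite -(rE (lift ord0 i', st.1 i')) zvec_zero sub0r oppr_le0 ler0n.
  by rewrite -(rE (lift ord0 i', st'.1 i')) zvec_zero subr0 ler0n.
have r_0 : r q.1 = 0.
  case: (eqVneq q.1 ord0) => [->|/rn0//].
  by move: r0; rewrite (bigD1 ord0) //= big1 ?addr0.
by apply/eqP; rewrite -(eqr_nat R) -subr_eq0 rE r_0.
Qed.

Lemma comb_zvec_surj m (c : 'I_h.+1 * 'I_k.+1 -> int)
    (lam : 'I_h.+1 * 'I_k.+1 -> R) :
  \sum_q c q = m%:Z -> (forall q, 0 <= lam q) ->
  \sum_q (c q)%:~R *: v q = \sum_q lam q *: v q ->
  exists2 st, st \in zcodes h k m &
    \sum_q (zvec st q)%:R *: v q = \sum_q (c q)%:~R *: v q.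
Proof.
move=> cm lam0 e.
have /choice[j_ jP] : forall i, exists j, forall j', c (i, j) <= c (i, j').
  move=> i; case: (arg_minP (P := xpredT) (fun j => c (i, j)) (i0 := ord0) isT).
  by move=> j _ jmin; exists j => j'; apply: jmin.
(* The minimum is subtracted on each block but [ord0], where the compensation could create negative
   values. *)
pose r := balance (fun i => c (i, j_ i)); have r0 : \sum_i r i = 0 := sum_balance _.
pose c' q := c q - r q.1.
have c'm : \sum_q c' q = m%:Z by rewrite sum_shift_coef.
have c'E : \sum_q (c' q)%:~R *: v q = \sum_q (c q)%:~R *: v q.
  exact: shift_coef.
have rn i : i != ord0 -> r i = c (i, j_ i) by rewrite /r /balance => /negbTE->.
have c'0 i : i != ord0 -> c' (i, j_ i) = 0.
  by move=> /rn; rewrite /c' /= => ->; rewrite subrr.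
have c'ge0 q : 0 <= c' q.
  case: q => i j; case: (eqVneq i ord0) => [->|ni]; last first.
    by rewrite /c' /= rn // subr_ge0.
  (* Comparison with [lam] settles block [ord0]: at a zero of [c'] in another block,
     [s i = lam >= 0], so [s ord0 <= 0] and [c' = lam - s ord0 >= 0]. *)
  have [s [s0 sE]] : exists s : 'I_h.+1 -> R,
      \sum_i s i = 0 /\ forall q, lam q - (c' q)%:~R = s q.1.
    by apply: comb_eq; rewrite c'E.
  have s_0 : s ord0 <= 0.
    move: s0; rewrite (bigD1 ord0) //= => /eqP; rewrite addr_eq0 => /eqP->.
    rewrite oppr_le0 sumr_ge0 // => i' ni'.
    by rewrite -(sE (i', j_ i')) c'0 // subr0.
  rewrite -(ler0z R) -[_%:~R](subKr (lam (ord0, j))) sE subr_ge0.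
  exact: le_trans s_0 (lam0 _).
pose w q := `|c' q|%N.
have wE q : (w q)%:Z = c' q by rewrite /w gez0_abs.
have [||st stF dst] := @zvec_surj h k m w.
- apply/eqP; rewrite -eqz_nat -c'm (big_morph Posz PoszD (erefl 0%:Z)).
  by apply/eqP/eq_bigr => q _; rewrite wE.
- by move=> i ni; exists (j_ i); rewrite /w c'0.
exists st => //; rewrite -c'E; apply: eq_bigr => q _.
by rewrite dst -wE.
Qed.

(** Scaled by [m.+1], the grid points of the polytope become lattice points of its dilate by [m.+1],
    which correspond bijectively to the codes of sum [m.+1]. *)
Lemma grid_countE m :
  grid_count [set t | point_polytope (aff_comb p b t)]%classic m =
  (#|zcodes h k m.+1|%:R)%:E.
Proof.
pose M := m.+1; have M0 : (M%:R : R) != 0 by rewrite pnatr_eq0.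
have Mge0 : 0 <= M%:R^-1 :> R by rewrite invr_ge0 ler0n.
have scaleM (z : 'I_d -> int) : aff_comb p b (fun i => (z i)%:~R / M%:R) =
    M%:R^-1 *: (M%:R *: p + \sum_i (z i)%:~R *: b i).
  rewrite scalerDr scalerA mulVf // scale1r /aff_comb; congr (_ + _).
  by rewrite scaler_sumr; apply: eq_bigr => i _; rewrite scalerA mulrC.
(* [e] sends a code to the coordinates of its point relative to [M%:R *: p]; its value 0 on other
   codes is a default. *)
have /choice[e eP] : forall st : zcode h k M, exists z : {ffun 'I_d -> int},
    st \in zcodes h k M ->
    \sum_q (zvec st q)%:R *: v q = M%:R *: p + \sum_i (z i)%:~R *: b i.
  move=> st; have [stF|] := boolP (st \in zcodes h k M); last first.
    by move=> _; exists 0.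
  have [|z zP] := @basis_span M%:Z (fun q => (zvec st q)%:Z).
    move: stF; rewrite inE => /eqP stF.
    by rewrite -[LHS](big_morph Posz PoszD (erefl 0%:Z)) sum_zvec stF.
  exists [ffun i => z i] => _.
  by rewrite [LHS]zP; congr (_ + _); apply: eq_bigr => i _; rewrite ffunE.
rewrite /grid_count (@reindex_esum _ _ _ [set` enum (mem (zcodes h k M))]%classic _ e).
  rewrite esum_fset; [|exact: finite_seq|by []].
  rewrite -fsbig_seq ?enum_uniq //.
  rewrite sumEFin /=; congr (_%:E).
  by rewrite big_const_seq count_predT -cardE iter_addr_0.
split.
- move=> st /=; rewrite mem_enum => stF.
  exists (fun q => (zvec st q)%:R / M%:R); split; [|split].
  + by move=> q; rewrite mulr_ge0 ?ler0n.
  + rewrite -mulr_suml -natr_sum sum_zvec.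
    by move: stF; rewrite inE => /eqP->; rewrite mulfV.
  + rewrite scaleM -eP // scaler_sumr; apply: eq_bigr => q _.
    by rewrite scalerA mulrC.
- move=> st st'; rewrite !inE /= !mem_enum => stF stF' ee.
  by apply: comb_zvec_inj; rewrite !eP // ee.
move=> z [lam [lam0 [lam1 lamE]]].
have [cp [cp1 pE]] := basis_point.
have /choice[c_ cP] := basis_vector.
pose c q := M%:Z * cp q + \sum_i z i * c_ i q.
have cE : \sum_q (c q)%:~R *: v q = M%:R *: p + \sum_i (z i)%:~R *: b i.
  under eq_bigr do rewrite intrD intrM scalerDl -scalerA.
  rewrite big_split /= -scaler_sumr -pE; congr (_ + _).
  under eq_bigr do rewrite rmorph_sum scaler_suml.
  rewrite exchange_big; apply: eq_bigr => i _ /=.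
  rewrite (proj2 (cP i)) scaler_sumr; apply: eq_bigr => q _.
  by rewrite intrM scalerA.
have cM : \sum_q c q = M%:Z.
  rewrite big_split /= -mulr_sumr cp1 mulr1 exchange_big big1 ?addr0 //= => i _.
  by rewrite -mulr_sumr (proj1 (cP i)) mulr0.
have [||st stF stE] := @comb_zvec_surj M c (fun q => M%:R * lam q) cM.
- by move=> q; rewrite mulr_ge0 ?ler0n.
- rewrite cE; under [RHS]eq_bigr do rewrite -scalerA.
  by rewrite -scaler_sumr -lamE scaleM scalerA mulfV // scale1r.
exists st; first by rewrite /= mem_enum.
apply/ffunP => i; move: i; apply/funeqP; apply: basis_inj.
by apply: (@addrI _ (M%:R *: p)); rewrite -eP // stE cE.
Qed.

End FreeSum.

(** * Asymptotics *)

Section Limits.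
Import numFieldNormedType.Exports.
Local Open Scope classical_set_scope.

(** Passing from [d] to [d.+1] multiplies the ratio by [(1 + (d + 1 - s) / (m + 1)) / (d + 1)] as
    soon as [s <= m], when the subtraction is not truncated. *)
Lemma cvg_binomial_ratio (R : realType) (s d : nat) :
  ('C(m.+1 - s + d, d)%:R / m.+1%:R ^+ d : R) @[m --> \oo] --> (d`!%:R^-1 : R).
Proof.
elim: d => [|d IH].
  under eq_fun do rewrite bin0 expr0 divr1.
  by rewrite fact0 invr1; exact: cvg_cst.
have -> : (d.+1)`!%:R^-1 = d`!%:R^-1 * ((1 + (d.+1%:R - s%:R) * 0) * d.+1%:R^-1) :> R.
  by rewrite mulr0 addr0 mul1r factS natrM invfM mulrC.
have lin : (1 + (d.+1%:R - s%:R) * harmonic m : R) @[m --> \oo] -->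
    (1 + (d.+1%:R - s%:R) * 0 : R).
  apply: cvgD; first exact: cvg_cst.
  by apply: cvgMl_tmp; exact: cvg_harmonic.
apply: cvg_trans (cvgM IH (cvgMr_tmp lin)).
apply: near_eq_cvg; exists s => // m /= les.
have lesm : (s <= m.+1)%N by exact: leqW.
have m0 : (m.+1%:R : R) != 0 by rewrite pnatr_eq0.
have d0 : (d.+1%:R : R) != 0 by rewrite pnatr_eq0.
have /(congr1 (fun x => x%:R : R)) := mul_bin_diag (m.+1 - s + d.+1) d.
rewrite addnS /= !natrM -addnS natrD natrB // => bE.
have -> : ('C(m.+1 - s + d.+1, d.+1)%:R : R) =
    (m.+1%:R - s%:R + d.+1%:R) * 'C(m.+1 - s + d, d)%:R / d.+1%:R.
  by rewrite bE mulrC mulKf.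
rewrite exprS; field.
by rewrite expf_neq0 // !nat1r m0 d0.
Qed.

Lemma has_volume_grid (R : realType) (d : nat) (S : set ('I_d -> R))
    (N : nat -> nat) (v : R) :
  (forall m, grid_count S m = (N m.+1)%:R%:E) ->
  ((N m.+1)%:R / m.+1%:R ^+ d : R) @[m --> \oo] --> v ->
  has_volume S v.
Proof.
move=> gE Nv; rewrite /has_volume.
under eq_fun do rewrite gE -EFinM.
by apply: cvg_EFin => //; near=> m.
Unshelve. all: by end_near. Qed.

(** Each of the [k.+1 ^ h] choices of zero positions contributes a binomial coefficient of the same
    leading order, hence the same limit. *)
Lemma free_sum_volume (R : realType) (n h k : nat)
    (v : 'I_h.+1 * 'I_k.+1 -> 'M[R]_n) :
  free_sum_relations v ->
  has_normalized_volume (point_polytope v) (point_lattice v)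
    ((h.+1 * k)`!%:R^-1 * (k.+1 ^ h)%:R).
Proof.
move=> relv d p b basisb.
apply: (@has_volume_grid _ _ _ (fun m => #|zcodes h k m|)).
  by move=> m; exact: grid_countE.
have -> : d = (h.+1 * k)%N := basis_size relv basisb.
have -> : (h.+1 * k)`!%:R^-1 * (k.+1 ^ h)%:R =
    \sum_(s : {ffun 'I_h -> 'I_k.+1}) (h.+1 * k)`!%:R^-1 :> R.
  by rewrite sumr_const card_ffun !card_ord mulr_natr.
have lim : (\sum_(s : {ffun 'I_h -> 'I_k.+1})
    ('C(m.+1 - \sum_i s i + h.+1 * k, h.+1 * k)%:R / m.+1%:R ^+ (h.+1 * k)) : R)
    @[m --> \oo] --> (\sum_(s : {ffun 'I_h -> 'I_k.+1}) (h.+1 * k)`!%:R^-1 : R).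
  apply: cvg_big => [|s _]; first exact: add_continuous.
  exact: cvg_binomial_ratio.
apply: cvg_trans lim.
apply: near_eq_cvg; exists (h * k)%N => // m /= lem.
by rewrite card_zcodes ?(leqW lem) // natr_sum mulr_suml.
Qed.

End Limits.

(** * The normalized volume of a Frobenius polytope *)

Theorem theorem2 (R : realType) (n : nat) (G H : {group {perm 'I_n}}) (a : 'I_n) :
  [transitive G, on [set: 'I_n] | 'P] ->
  H = 'C_G[a | 'P]%G :> {set _} ->
  frobenius_complement G H ->
  let h := #|H| in
  let k := #|frobenius_kernel G| in
  has_normalized_volume (perm_polytope (R:=R) G) (vertex_lattice (R:=R) G)
    ((((h * k - h)`!)%:R)^-1 *
     \sum_(0 <= l < ((h * (k - 1) - 1) %/ k).+1)
        ('C((h - l) * k, (h - l) * k - h + 1)%:R * 'C(h - 1, l)%:R * (-1) ^+ l)).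
Proof.
move=> trG defH frobH.
have [K [defK cKn ltHK cardG fix1]] := frobenius_kernel_group trG defH frobH.
move=> h k; rewrite frobenius_alternating_sum ?cardG_gt0 // /k ?defK // {}/h {k}.
have : (0 < #|H|)%N by exact: cardG_gt0.
have : (0 < #|K|)%N by exact: cardG_gt0.
case cK: #|K| => [//|k] _; case cH: #|H| => [//|h] _.
have [f [injf imf relf]] := frobenius_configuration R defK cKn fix1 defH cardG cH cK.
have sumf (V : nmodType) (F : {perm 'I_n} -> V) : \sum_(g in G) F g = \sum_q F (f q).
  rewrite -imf big_imset /=; last by move=> ? ? _ _; exact: injf.
  by apply: eq_bigl => q; rewrite finset.in_setT.
(* A left inverse of [f], to carry coefficients between [G] and the index pairs; its value outside
   [G] is arbitrary. *)
pose f' g := if [pick q | f q == g] is Some q then q else (ord0, ord0).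
have fK : cancel f f'.
  by move=> q; rewrite /f'; case: pickP => [q' /eqP/injf|/(_ q)]; rewrite ?eqxx.
have -> : perm_polytope G = point_polytope (fun q => pmat R (f q)).
  apply/seteqP; split => M /=.
    move=> [lam [lam0 [lam1 ->]]]; exists (lam \o f).
    by split=> [q|]; [exact: lam0 | rewrite -lam1 !sumf].
  move=> [lam [lam0 [lam1 ->]]]; exists (lam \o f').
  split=> [q|]; first exact: lam0.
  by rewrite !sumf -lam1; split; apply: eq_bigr => q _ /=; rewrite fK.
have -> : vertex_lattice G = point_lattice (fun q => pmat R (f q)).
  apply/seteqP; split => M /= [c [c1 ->]].
    by exists (c \o f); rewrite -c1 !sumf.
  exists (c \o f').
  by rewrite !sumf -c1; split; apply: eq_bigr => q _ /=; rewrite fK.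
have -> : (h.+1 * k.+1 - h.+1 = h.+1 * k)%N by rewrite mulnS addKn.
by rewrite subn1; exact: free_sum_volume.
Qed.
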